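(* Let $n, c, q$ be integers with $n > c \geq q \geq 1$. Every collection of directed graphs $G_1, \ldots, G_c$ on a common set of $n$ vertices containing no rainbow $S_{0,q}$ satisfies \[\sum_{i=1}^c e(G_i) \leq (q-1)(n^2-n).\] Moreover, this bound is sharp: for all such $n,c,q$ there is a collection $G_1,\ldots,G_c$ on $n$ common vertices with no rainbow $S_{0,q}$ attaining equality.
   Context: Each $G_i$ is a directed graph without loops or multiple edges on the common vertex set $V$ (for distinct $u,v$, the edges $uv$ and $vu$ may both be present); $e(G_i)$ denotes the number of directed edges of $G_i$. Think of $G_i$ as the edges of color $i$. For integers $p,q\ge 0$, $S_{p,q}$ denotes the orientation of a star on $p+q+1$ vertices whose center has indegree $p$ and outdegree $q$ (all other vertices are leaves). The collection $(G_1,\ldots,G_c)$ contains a rainbow copy of a directed graph $F$ if there exist an injective map $f: V(F)\to V$ and an injective map $\varphi: E(F)\to\{1,\ldots,c\}$ such that for every edge $xy\in E(F)$, the edge $f(x)f(y)$ belongs to $G_{\varphi(xy)}$. *)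

(* Defs.v *)
From mathcomp Require Import all_boot.

Set Implicit Arguments.
Unset Strict Implicit.
Unset Printing Implicit Defensive.

Record digraph (V : finType) := Digraph {
  arc :> rel V;
  arc_irr : irreflexive arc
}.

Definition edges (V : finType) (G : digraph V) : {set V * V} :=
  [set e | G e.1 e.2].

(* [phi] is defined on the subtype of edges of [F] only, so that an edgeless
   [F] imposes no condition on the number [c] of colors. *)
Definition rainbow_copy (V W : finType) (c : nat)
    (G : 'I_c -> digraph V) (F : digraph W) : Prop :=
  exists f : W -> V, exists phi : {e : W * W | e \in edges F} -> 'I_c,
    [/\ injective f, injective phi &
        forall e : {e : W * W | e \in edges F},
          G (phi e) (f (val e).1) (f (val e).2)].

(* The center of the star S_{p,q} is [None]; [Some (inl i)] are the p
   in-leaves and [Some (inr j)] the q out-leaves. *)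
Definition star_rel (p q : nat) : rel (option ('I_p + 'I_q)) :=
  fun x y => match x, y with
             | Some (inl _), None => true
             | None, Some (inr _) => true
             | _, _ => false
             end.

Lemma star_irr (p q : nat) : irreflexive (@star_rel p q).
Proof. by do 2?case. Qed.

Definition star (p q : nat) : digraph (option ('I_p + 'I_q)) :=
  Digraph (@star_irr p q).

(* Main.v *)
Require Import Defs.
From mathcomp Require Import all_boot all_algebra.

(** Fix a center x. The pairs (color, out-neighbor) form a bipartite graph in
    which a rainbow S_{0,q} centered at x is a matching of size q. Since
    c <= n - 1, the complete bipartite graph K_{c,n-1} splits into n - 1
    matchings (the cyclic shifts), each containing at most q - 1 of these pairs;
    hence the outdegrees of x over all colors add up to at most (q - 1)(n - 1).
    Equality holds for q - 1 complete digraphs and c - q + 1 empty ones. *)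

Lemma sum_card_no_matching (c q : nat) (T : finType) (E : 'I_c -> pred T) :
  0 < q -> c <= #|T| ->
  (forall (a : 'I_q -> 'I_c) (b : 'I_q -> T),
      injective a -> injective b -> ~ (forall j, E (a j) (b j))) ->
  \sum_(i < c) #|E i| <= q.-1 * #|T|.
Proof.
move=> q_gt0; case eT: #|T| => [|m] le_cT noM.
  (* If [T] is empty there are no colors, and the sum is empty. *)
  by move: le_cT E noM; case: c => // _ E _; rewrite big_ord0.
(* [f] labels [T] by the cyclic group of order [m.+1], whose addition provides the shifts. *)
pose f (k : 'I_m.+1) : T := enum_val (cast_ord (esym eT) k).
have f_inj : injective f by move=> k l /enum_val_inj /cast_ord_inj.
have f_bij : bijective f by apply: inj_card_bij => //; rewrite eT card_ord.
(* Shift [k] pairs color [i] with [y i k]. For fixed [k] this is injective in [i], as colors embed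
   in the group; for fixed [i] it runs through [T] once, so the shifts partition all pairs. *)
pose y i k := f (GRing.add (widen_ord le_cT i) k).
have y_injl k : injective (y^~ k).
  by move=> i j /f_inj /GRing.addIr /(congr1 val) /= /val_inj.
have card_shift i : #|E i| = \sum_(k < m.+1) E i (y i k).
  have y_bij : bijective (y i).
    apply: inj_card_bij; first by move=> k l /f_inj /GRing.addrI.
    by rewrite eT card_ord.
  rewrite -sum1_card big_mkcond (reindex (y i)) /=; last exact: onW_bij.
  by apply: eq_bigr => k _; rewrite unfold_in; case: (E i _).
rewrite (eq_bigr _ (fun i _ => card_shift i)) exchange_big /= mulnC.
rewrite -[X in X * _]card_ord -sum_nat_const; apply: leq_sum => k _.
pose A := [set i | E i (y i k)].
have -> : \sum_(i < c) E i (y i k) = #|A|.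
  rewrite -sum1_card [RHS]big_mkcond; apply: eq_bigr => i _.
  by rewrite inE; case: (E i _).
(* If [A] had [q] elements, these colors and their partners in shift [k] would form a forbidden
   matching. *)
rewrite -ltnS prednK // ltnNge; apply/negP => le_qA.
pose a (j : 'I_q) := enum_val (widen_ord le_qA j).
have a_inj : injective a by move=> i j /enum_val_inj /(congr1 val) /= /val_inj.
apply: (noM a (fun j => y (a j) k)) => // [i j /y_injl /a_inj //|j].
by have := enum_valP (widen_ord le_qA j); rewrite inE.
Qed.

Lemma star_edges (q : nat) (e : option ('I_0 + 'I_q) * option ('I_0 + 'I_q)) :
  e \in edges (star 0 q) -> exists j, e = (None, Some (inr j)).
Proof. by rewrite inE; case: e => [[[[]//|?]|] [[[]//|j]|]] //= _; exists j. Qed.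

(** Looplessness keeps the leaves [b j] away from the center [x]. *)
Lemma rainbow_out_star (V : finType) (c q : nat) (G : 'I_c -> digraph V) (x : V)
    (a : 'I_q -> 'I_c) (b : 'I_q -> V) :
  0 < q -> injective a -> injective b -> (forall j, G (a j) x (b j)) ->
  rainbow_copy G (star 0 q).
Proof.
move=> q_gt0 a_inj b_inj Gab.
have b_neq j : b j <> x by move=> bx; move: (Gab j); rewrite bx arc_irr.
exists (fun w : option ('I_0 + 'I_q) =>
          if w is Some (inr j) then b j else x).
(* Every edge of the star ends in an out-leaf, so the default color [a (Ordinal q_gt0)] is never
   taken. *)
exists (fun e : {e | e \in edges (star 0 q)} =>
          if (val e).2 is Some (inr j) then a j else a (Ordinal q_gt0)).
split.
- move=> [[[]//|i]|] [[[]//|j]|] //=; first by move/b_inj->.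
    by move/b_neq.
  by move/esym/b_neq.
- move=> e1 e2; case: (star_edges _ _ (valP e1)) => i e1E.
  case: (star_edges _ _ (valP e2)) => j e2E.
  rewrite e1E e2E /= => /a_inj ij; apply: val_inj.
  by rewrite e1E e2E ij.
- by move=> e; case: (star_edges _ _ (valP e)) => j -> /=.
Qed.

(** Counting out-neighbors among the vertices other than [x] loses nothing without loops, and yields
    the factor [#|V|.-1] rather than [#|V|] in the bound. *)
Lemma card_edges_outdegree (V : finType) (G : digraph V) :
  #|edges G| = \sum_(x : V) #|[pred y : {y | y != x} | G x (val y)]|.
Proof.
rewrite -sum1dep_card -(pair_big_dep xpredT G (fun _ _ => 1)) /=.
apply: eq_bigr => x _; rewrite sum1_card.
rewrite -[RHS](card_imset _ val_inj); apply: eq_card => y.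
rewrite -[LHS]/(G x y); apply/idP/imsetP => [Gxy|[z Gxz ->]]; last first.
  by move: Gxz; rewrite inE.
have yx : y != x by apply: contraTneq Gxy => ->; rewrite arc_irr.
by exists (exist _ y yx).
Qed.

Lemma card_neq (V : finType) (x : V) : #|{: {y | y != x}}| = #|V|.-1.
Proof. by rewrite card_sig -(cardC1 x); apply: eq_card. Qed.

Lemma complete_irr (V : finType) (b : bool) :
  irreflexive (fun x y : V => b && (x != y)).
Proof. by move=> x; rewrite eqxx andbF. Qed.

Definition complete_if (V : finType) (b : bool) : digraph V :=
  Digraph (@complete_irr V b).

Lemma card_complete_if (V : finType) (b : bool) :
  #|edges (complete_if V b)| = b * (#|V| * #|V|.-1).
Proof.
rewrite card_edges_outdegree mulnC -mulnA -sum_nat_const.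
apply: eq_bigr => x _; case: b; last by rewrite muln0; apply: eq_card0.
rewrite muln1 -(card_neq V x); apply: eq_card => -[y yx].
by rewrite !inE /= eq_sym yx.
Qed.

(** Pigeonhole: the [q] edges of the star need distinct colors, but only colors below [m] have
    arcs. *)
Lemma no_rainbow_star_few_colors (V : finType) (c q m : nat)
    (G : 'I_c -> digraph V) :
  m < q -> (forall i x y, G i x y -> i < m) -> ~ rainbow_copy G (star 0 q).
Proof.
move=> lt_mq Gm [f [phi [_ phi_inj Gphi]]].
have starE (j : 'I_q) : (None, Some (inr j)) \in edges (star 0 q).
  by rewrite inE.
pose e j : {e | e \in edges (star 0 q)} :=
  exist (fun e => e \in edges (star 0 q)) _ (starE j).
pose g j : 'I_m := Ordinal (Gm _ _ _ (Gphi (e j))).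
have /leq_card : injective g.
  by move=> i j /(congr1 val) /= /val_inj /phi_inj /(congr1 val) [].
by rewrite !card_ord leqNgt lt_mq.
Qed.

Theorem theorem1 (n c q : nat) (hcn : c < n) (hqc : q <= c) (hq : 1 <= q) :
  (forall (V : finType) (G : 'I_c -> digraph V),
      #|V| = n ->
      ~ rainbow_copy G (star 0 q) ->
      \sum_(i < c) #|edges (G i)| <= (q - 1) * (n ^ 2 - n))
  /\
  (exists G : 'I_c -> digraph 'I_n,
      ~ rainbow_copy G (star 0 q) /\
      \sum_(i < c) #|edges (G i)| = (q - 1) * (n ^ 2 - n)).
Proof.
have -> : n ^ 2 - n = n * n.-1 by rewrite -subn1 mulnBr muln1.
rewrite subn1; split.
  move=> V G cardV noR.
  rewrite (eq_bigr _ (fun i _ => card_edges_outdegree _ (G i))) exchange_big /=.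
  rewrite mulnCA -{1}cardV -sum_nat_const; apply: leq_sum => x _.
  have cardx : #|{: {y | y != x}}| = n.-1 by rewrite card_neq cardV.
  rewrite -cardx; apply: sum_card_no_matching => //.
    (* Here [c < n] gives [c <= n.-1], so that the colors fit into the possible out-neighbors of
       [x]. *)
    by rewrite cardx; case: n hcn {cardV cardx}.
  move=> a b a_inj b_inj Gab; apply: noR.
  by apply: (rainbow_out_star _ _ _ _ x a (val \o b)) => //; exact: inj_comp val_inj b_inj.
exists (fun i => complete_if 'I_n (i < q.-1)); split.
  apply: (no_rainbow_star_few_colors _ _ _ q.-1); first by rewrite ltn_predL.
  by move=> i x y /andP[].
under eq_bigr do rewrite card_complete_if card_ord.
rewrite -big_distrl /=; congr (_ * _); rewrite -big_mkcond /=.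
(* As [q.-1 <= c], exactly [q.-1] colors lie below [q.-1]. *)
rewrite -(big_ord_widen c (fun=> 1)) ?sum1_card ?card_ord //.
exact: leq_trans (leq_pred q) hqc.
Qed.
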